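(* Let $\alpha,\beta,\gamma,\delta$ be integers and let the Taylor (formal power series) expansion of $$ x(\alpha+\beta x)\prod_{k\ge1}\left(1+\gamma x^{2^k-1}+\delta x^{2^k}\right) $$ be $a(0)+a(1)x+a(2)x^2+\cdots$. Then $a(0)=0$, $a(1)=\alpha$, and for $n\ge2$, writing $n=2^k+i$ with $k\ge1$ and $0\le i\le 2^k-1$, $$ a(2^k+i)=\begin{cases} \alpha\gamma+\beta\delta^{k-1}, & i=0;\\ \delta a(i)+\gamma a(i+1), & i=1,\ldots,2^k-2;\\ \delta a(i)+\gamma a(i+1)-\alpha\gamma^2, & i=2^k-1.\end{cases} $$ *)

(* Defs.v *)
From mathcomp Require Import all_boot all_order all_algebra.
Set Implicit Arguments.
Unset Strict Implicit.
Unset Printing Implicit Defensive.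
Import GRing.Theory.
Local Open Scope ring_scope.

(** A formal power series is given by its coefficients: [f : fps R] stands for
    f(0) + f(1) x + f(2) x^2 + .... *)
Definition fps (R : nzRingType) := nat -> R.

Definition fps_of_poly (R : nzRingType) (p : {poly R}) : fps R := fun n => p`_n.

(** Cauchy product *)
Definition fps_mul (R : nzRingType) (f g : fps R) : fps R :=
  fun n => \sum_(i < n.+1) f i * g (n - i)%N.

(** Convergence in the x-adic sense: each coefficient is eventually constant. *)
Definition fps_cvg (R : nzRingType) (s : nat -> fps R) (l : fps R) : Prop :=
  forall n, exists M, forall m, (M <= m)%N -> s m n = l n.

(** [P] is the infinite product of the polynomials [F k] over [k >= 1]. *)
Definition is_infprod (R : nzRingType) (F : nat -> {poly R}) (P : fps R) : Prop :=
  fps_cvg (fun m => fps_of_poly (\prod_(1 <= k < m.+1) F k)) P.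

Definition factor (gamma delta : int) (k : nat) : {poly int} :=
  1 + gamma *: 'X^(2 ^ k - 1) + delta *: 'X^(2 ^ k).

Definition is_expansion (alpha beta gamma delta : int) (a : fps int) : Prop :=
  exists2 P : fps int, is_infprod (factor gamma delta) P &
    a =1 fps_mul (fps_of_poly ('X * (alpha%:P + beta *: 'X))) P.

(** The infinite product converges, so the expansion exists, and it is unique. *)
Lemma is_expansion_exists (alpha beta gamma delta : int) :
  exists a, is_expansion alpha beta gamma delta a.
Proof.
pose P : fps int := fun n => (\prod_(1 <= k < n.+1) factor gamma delta k)`_n.
suff hP : is_infprod (factor gamma delta) P.
  by exists (fps_mul (fps_of_poly ('X * (alpha%:P + beta *: 'X))) P), P.
move=> n; exists n => m; elim: m => [|m IHm].
  by rewrite leqn0 => /eqP n0; rewrite /fps_of_poly /P n0.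
rewrite leq_eqVlt => /predU1P[-> //|]; rewrite ltnS => le_nm.
rewrite -(IHm le_nm) /fps_of_poly big_nat_recr //= /factor.
have lt_n : (n < 2 ^ m.+1 - 1)%N.
  by rewrite ltn_subRL add1n (leq_trans _ (ltn_expl m.+1 (ltnSn 1))).
have lt_n' := leq_trans lt_n (leq_subr 1 _).
by rewrite !mulrDr mulr1 -!scalerAr !coefD !coefZ !coefMXn lt_n lt_n' !mulr0 !addr0.
Qed.

Lemma is_expansion_unique (alpha beta gamma delta : int) (a b : fps int) :
  is_expansion alpha beta gamma delta a ->
  is_expansion alpha beta gamma delta b -> a =1 b.
Proof.
move=> [P hP ha] [Q hQ hb] n; rewrite ha hb; apply: eq_bigr => i _; congr (_ * _).
have [M hM] := hP (n - i)%N; have [M' hM'] := hQ (n - i)%N.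
by rewrite -(hM _ (leq_maxl M M')) -(hM' _ (leq_maxr M M')).
Qed.

(* Main.v *)
Require Import Defs.
From mathcomp Require Import all_boot all_order all_algebra.
From mathcomp Require Import zify ring.
Import GRing.Theory.
Local Open Scope ring_scope.

(** Let A_m be the product of x(alpha + beta x) with the factors k = 1, ..., m.
    It has degree at most 2^(m+1), with coefficient beta delta^m there, while the
    factor m+1 only changes coefficients from x^(2^(m+1)) on, because A_m has no
    constant term.  Hence a(n) is the coefficient of x^n in A_m for n < 2^(m+1),
    and the recurrence is read off A_k = A_(k-1) (1 + gamma x^(2^k-1) + delta x^(2^k)).
    The correction -alpha gamma^2 for i = 2^k-1 arises because the coefficient of
    x^(2^k) in A_(k-1) is a(2^k) - alpha gamma. *)

(** A coefficient of a Cauchy product involves all lower coefficients of the series, so it needs one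
    bound serving them all; a maximum of finitely many bounds does. *)
Lemma fps_cvg_le {R : nzRingType} {s : nat -> fps R} {l : fps R} (n : nat) :
  fps_cvg s l ->
  exists M, forall m i, (M <= m)%N -> (i <= n)%N -> s m i = l i.
Proof.
move=> sl; elim: n => [|n [M hM]].
  by have [M hM] := sl 0%N; exists M => m i /hM ?; rewrite leqn0 => /eqP->.
have [M' hM'] := sl n.+1; exists (maxn M M') => m i.
rewrite geq_max => /andP[leM leM']; rewrite leq_eqVlt ltnS.
by case/predU1P => [->|]; [apply: hM' | apply: hM].
Qed.

Lemma fps_cvg_mul_poly (R : nzRingType) (p : {poly R}) (q : nat -> {poly R})
    (P : fps R) :
  fps_cvg (fun m => fps_of_poly (q m)) P ->
  fps_cvg (fun m => fps_of_poly (p * q m)) (fps_mul (fps_of_poly p) P).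
Proof.
move=> qP n; have [M hM] := fps_cvg_le n qP; exists M => m leMm.
rewrite /fps_of_poly coefM; apply: eq_bigr => i _.
by rewrite -(hM m _ leMm) ?leq_subr.
Qed.

Definition partial_prod (alpha beta gamma delta : int) (m : nat) : {poly int} :=
  'X * (alpha%:P + beta *: 'X) * \prod_(1 <= k < m.+1) factor gamma delta k.

Section PartialProducts.

Variables alpha beta gamma delta : int.
Local Notation A := (partial_prod alpha beta gamma delta).

Lemma coef_partial_prod0 n :
  (A 0)`_n = alpha *+ (n == 1)%N + beta *+ (n == 2)%N.
Proof.
rewrite /partial_prod big_geq // mulr1 mulrC coefMX coefD coefC coefZ coefX.
by case: n => [|[|[|n]]] //=; ring.
Qed.

Lemma coef_partial_prodS m n :
  (A m.+1)`_n = (A m)`_n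
    + gamma * (if (n < 2 ^ m.+1 - 1)%N then 0 else (A m)`_(n - (2 ^ m.+1 - 1)))
    + delta * (if (n < 2 ^ m.+1)%N then 0 else (A m)`_(n - 2 ^ m.+1)).
Proof.
rewrite /partial_prod big_nat_recr //= mulrA {2}/factor.
by rewrite !mulrDr mulr1 -!scalerAr !coefD !coefZ !coefMXn.
Qed.

Lemma coef0_partial_prod m : (A m)`_0 = 0.
Proof. by rewrite /partial_prod -mulrA coefXM. Qed.

(** The degrees add up to at most 2 + (2 + 4 + ... + 2^m) = 2^(m+1). *)
Lemma coef_partial_prod_gt m n : (2 ^ m.+1 < n)%N -> (A m)`_n = 0.
Proof.
elim: m n => [|m IHm] n lt_n.
  by rewrite coef_partial_prod0; case: n lt_n => [|[|[|n]]].
move: lt_n; rewrite expnS => lt_n; rewrite coef_partial_prodS !IHm; try lia.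
by rewrite !if_same; ring.
Qed.

Lemma coef_partial_prod_max m : (A m)`_(2 ^ m.+1) = beta * delta ^+ m.
Proof.
elim: m => [|m IHm]; first by rewrite coef_partial_prod0 /=; ring.
have pow_gt0 : (0 < 2 ^ m.+1)%N by rewrite expn_gt0.
rewrite coef_partial_prodS (expnS 2 m.+1).
(* Only the [delta] term survives: the other two read [A m] at 2^(m+2) and 2^(m+1) + 1, beyond its
   degree. *)
rewrite (coef_partial_prod_gt m (2 * 2 ^ m.+1)%N); last by lia.
rewrite (coef_partial_prod_gt m (2 * 2 ^ m.+1 - (2 ^ m.+1 - 1))%N); last by lia.
have -> : (2 * 2 ^ m.+1 - 2 ^ m.+1 = 2 ^ m.+1)%N by lia.
rewrite IHm if_same ltnNge leq_pmull //= exprS; ring.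
Qed.

Lemma coef_partial_prod_stable m m' n :
  (m <= m')%N -> (n < 2 ^ m.+1)%N -> (A m')`_n = (A m)`_n.
Proof.
move=> le_mm' lt_n; elim: m' le_mm' => [|m' IHm'].
  by rewrite leqn0 => /eqP->.
rewrite leq_eqVlt ltnS => /predU1P[<- //|le_mm'].
have {}lt_n : (n < 2 ^ m'.+1)%N by rewrite (leq_trans lt_n) // leq_pexp2l.
rewrite coef_partial_prodS lt_n IHm' //; case: ltnP => [_|le_n]; first by ring.
(* Now n = 2^(m'+1) - 1, the only index in range that the [gamma] term reaches, and there it reads
   the zero constant term. *)
have -> : (n - (2 ^ m'.+1 - 1) = 0)%N by lia.
by rewrite coef0_partial_prod; ring.
Qed.

Lemma expansion_coef a m n : is_expansion alpha beta gamma delta a ->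
  (n < 2 ^ m.+1)%N -> a n = (A m)`_n.
Proof.
move=> [P hP ha] lt_n; rewrite ha.
have [M hM] := fps_cvg_mul_poly _ ('X * (alpha%:P + beta *: 'X)) _ _ hP n.
rewrite -(hM _ (leq_maxr m M)); apply: coef_partial_prod_stable lt_n.
exact: leq_maxl.
Qed.

End PartialProducts.

Arguments expansion_coef {alpha beta gamma delta a} m {n}.

Theorem theorem6 (alpha beta gamma delta : int) (a : fps int)
    (ha : is_expansion alpha beta gamma delta a) :
  [/\ a 0%N = 0,
      a 1%N = alpha &
      forall n k i : nat, (2 <= n)%N -> n = (2 ^ k + i)%N ->
        (1 <= k)%N -> (i <= 2 ^ k - 1)%N ->
        [/\ i = 0%N ->
              a n = alpha * gamma + beta * delta ^+ (k - 1),
            (1 <= i <= 2 ^ k - 2)%N ->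
              a n = delta * a i + gamma * a i.+1 &
            i = (2 ^ k - 1)%N ->
              a n = delta * a i + gamma * a i.+1 - alpha * gamma ^+ 2]].
Proof.
have a0 : a 0 = 0 by rewrite (expansion_coef 0 ha) // coef0_partial_prod.
have a1 : a 1 = alpha.
  by rewrite (expansion_coef 0 ha) // coef_partial_prod0 /=; ring.
split=> // n [//|k] i _ -> _ le_i; rewrite subn1 /=.
(* The exponent of the statement is now [k.+1], so [A] stops just before the factor that yields the
   recurrence. *)
set A := partial_prod alpha beta gamma delta k.
have pow_gt1 : (1 < 2 ^ k.+1)%N by rewrite (ltn_exp2l 0).
have a_lt j : (j < 2 ^ k.+1)%N -> a j = A`_j by exact: expansion_coef.
(* The [gamma] term keeps a coefficient of [A], since it may differ from [a j.+1] when [j.+1] is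
   2^(k+1). *)
have a_rec j : (j <= 2 ^ k.+1 - 1)%N ->
    a (2 ^ k.+1 + j)%N = A`_(2 ^ k.+1 + j) + gamma * A`_j.+1 + delta * a j.
  move=> le_j; rewrite (a_lt j); last by lia.
  rewrite (expansion_coef k.+1 ha); last by rewrite (expnS 2 k.+1); lia.
  rewrite coef_partial_prodS !ifF; try lia.
  have -> : (2 ^ k.+1 + j - (2 ^ k.+1 - 1) = j.+1)%N by lia.
  by rewrite addKn.
have a_pow : a (2 ^ k.+1)%N = alpha * gamma + beta * delta ^+ k.
  rewrite -[(2 ^ k.+1)%N]addn0 a_rec // addn0 coef_partial_prod_max.
  by rewrite -a_lt // a0 a1; ring.
have A_gt j : (0 < j)%N -> A`_(2 ^ k.+1 + j) = 0.
  by move=> j_gt0; apply: coef_partial_prod_gt; lia.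
split=> [->|i_mid|i_max]; first by rewrite addn0.
- by rewrite a_rec // A_gt ?a_lt; [ring|lia..].
- rewrite a_rec // A_gt; last by lia.
  have -> : i.+1 = (2 ^ k.+1)%N by lia.
  by rewrite coef_partial_prod_max a_pow; ring.
Qed.
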